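(* Let $k\ge2$ be even and $n\ge1$. Then $N''_{k,1,n}=(C_{k/2,n})^2=D'_{k,(k/2)^2n,\,n}$.
   Context: For $j\ge1$, a $j$-dimensional balanced ballot path of length $jn$ is a sequence of $jn$ standard unit vectors of $\mathbb{R}^j$, each $\vec e_i$ occurring exactly $n$ times, such that every intermediate point (partial sum) $\vec x=(x_1,\dots,x_j)$ satisfies $x_1\ge\cdots\ge x_j$; $C_{j,n}$ denotes the number of such paths. For a $k$-dimensional balanced ballot path, steps $\vec e_i$ with $i\le\lfloor k/2\rfloor$ are semisymmetric up-steps and steps $\vec e_j$ with $j\ge\lceil k/2\rceil+1$ are semisymmetric down-steps; a semisymmetric peak is an occurrence of a semisymmetric up-step immediately followed by a semisymmetric down-step. $N''_{k,\alpha,n}$ is the number of $k$-dimensional balanced ballot paths of length $kn$ with exactly $\alpha$ semisymmetric peaks. The semisymmetric height of $\vec x\in\mathbb{Z}^k_{\ge0}$ is $g_k(\vec x)=\sum_{i=1}^k(k+1-2i)x_i$, the semisymmetric height of a path is the maximum of $g_k$ over its intermediate points, and $D'_{k,u,n}$ is the number of $k$-dimensional balanced ballot paths of length $kn$ with semisymmetric height exactly $u$. *)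

(* Defs.v *)
From mathcomp Require Import all_boot all_order all_algebra.

Set Implicit Arguments.
Unset Strict Implicit.
Unset Printing Implicit Defensive.

(* A path is the sequence of the indices of its steps; the index [i : 'I_k] is
   0-based and stands for the unit vector e_{i+1} of R^k. *)

(* The point reached after the first [m] steps: its coordinate [i] is the number
   of occurrences of e_{i+1} among them. *)
Definition point k (w : seq 'I_k) (m : nat) : 'I_k -> nat :=
  fun i => count_mem i (take m w).

Definition weakly_decreasing k (x : 'I_k -> nat) : bool :=
  [forall i : 'I_k, forall j : 'I_k, (i <= j) ==> (x j <= x i)].

Definition balanced_ballot k n (w : (k * n).-tuple 'I_k) : bool :=
  [forall i : 'I_k, count_mem i w == n] &&
  [forall m : 'I_(k * n).+1, weakly_decreasing (point w m)].

Definition num_ballot (j n : nat) : nat :=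
  #|[set w : (j * n).-tuple 'I_j | balanced_ballot w]|.

Definition up_step k (i : 'I_k) : bool := i.+1 <= k./2.

(* [uphalf k] is the ceiling of k/2. *)
Definition down_step k (j : 'I_k) : bool := (uphalf k).+1 <= j.+1.

Definition num_peaks k (w : seq 'I_k) : nat :=
  count (fun p => up_step p.1 && down_step p.2) (zip w (behead w)).

Definition num_ballot_peaks (k alpha n : nat) : nat :=
  #|[set w : (k * n).-tuple 'I_k |
      balanced_ballot w && (num_peaks w == alpha)]|.

(* The coefficient k + 1 - 2i of x_i, with the 1-based i of the definition, can
   be negative, so the height takes values in [int]. *)
Definition point_height k (x : 'I_k -> nat) : int :=
  (\sum_(i < k) (k.+1%:Z - (2 * i.+1)%N%:Z) * (x i)%:Z)%R.

(* Taking the starting point as the default value of the maximum is harmless: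
   it is one of the points over which the maximum ranges. *)
Definition path_height k (w : seq 'I_k) : int :=
  \big[Order.max/point_height (point w 0)]_(m < (size w).+1)
     point_height (point w m).

Definition num_ballot_height (k : nat) (u : int) (n : nat) : nat :=
  #|[set w : (k * n).-tuple 'I_k |
      balanced_ballot w && (path_height w == u)]|.

(* Main.v *)
Require Import Defs.
From mathcomp Require Import all_boot all_order all_algebra.
From mathcomp Require Import zify.

Set Implicit Arguments.
Unset Strict Implicit.
Unset Printing Implicit Defensive.

(** Write k = 2j. Both outer numbers count the balanced ballot paths in which every up-step precedes
    every down-step. Such a path is a concatenation of two j-dimensional balanced ballot paths, one
    on the first j coordinates and one on the last j. Conversely every concatenation is a ballot
    path: while a down-coordinate grows, all up-coordinates already equal n. Hence there are
    [num_ballot j n ^ 2] of them ([ballot_join], [split_join], [card_ballot_join]). Peaks: a ballot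
    path starts with the first unit vector, an up-step, and ends with the last one, a down-step;
    with a single peak it can only be a block of ups followed by a block of downs
    ([one_peak_split]). Height: on the box where all coordinates are at most n, the height is j^2 n
    minus a combination of the n - x_i (i at most j) and the x_i (i > j) with positive coefficients
    ([point_heightE]). So height j^2 n is the maximum and is attained only at (n,...,n,0,...,0),
    which a path visits exactly when its ups precede its downs. *)

Lemma size_sum_count (T : finType) (s : seq T) :
  size s = \sum_(i : T) count_mem i s.
Proof.
elim: s => [|x s IHs] /=; first by rewrite big1.
rewrite big_split /= -IHs (bigD1 x) //= eqxx big1 ?addn0 // => i.
by rewrite eq_sym => /negbTE->.
Qed.

(** * Ballot paths: prefix counts, first step and last step *)

Section BallotPaths.

Variables (k n : nat).
Implicit Type w : (k * n).-tuple 'I_k.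

Lemma balanced_ballotP w :
  reflect ((forall i, count_mem i w = n) /\
           (forall m (i j : 'I_k), i <= j ->
              count_mem j (take m w) <= count_mem i (take m w)))
          (balanced_ballot w).
Proof.
apply: (iffP andP) => -[cnt dec]; split.
- by move=> i; apply/eqP/(forallP cnt).
- move=> m i j le_ij.
  have H (p : 'I_(k * n).+1) : count_mem j (take p w) <= count_mem i (take p w).
    by have /forallP/(_ i)/forallP/(_ j)/implyP := forallP dec p; apply.
  have [lt_m|le_m] := ltnP m (k * n).+1; first exact: (H (Ordinal lt_m)).
  have := H ord_max; rewrite /= !take_oversize ?size_tuple //; exact: ltnW.
- by apply/forallP => i; rewrite cnt.
- apply/forallP => m; apply/forallP => i; apply/forallP => j; apply/implyP.
  exact: dec.
Qed.

Lemma count_take_le w (i : 'I_k) m :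
  balanced_ballot w -> count_mem i (take m w) <= n.
Proof.
case/balanced_ballotP=> cnt _.
by rewrite -[X in _ <= X](cnt i) -{2}(cat_take_drop m w) count_cat leq_addr.
Qed.

(** After one step the coordinate of [x] is 1, and coordinate 0 must be at least as large. *)
Lemma ballot_head w x s :
  balanced_ballot w -> val w = x :: s -> val x = 0.
Proof.
case/balanced_ballotP=> _ dec Ew.
have k_gt0 : 0 < k by case: x {Ew} => x /= /(leq_ltn_trans (leq0n x)).
have /(_ (leq0n _)) := dec 1 (Ordinal k_gt0) x.
by rewrite Ew /= take0 /= eqxx !addn0; case: eqP => // ->.
Qed.

(** Just before the last step, coordinate [x] is n - 1 while all others are already n; if [x] were
    not the last index, the last coordinate would exceed it. *)
Lemma ballot_last w x s :
  balanced_ballot w -> val w = rcons s x -> x.+1 = k.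
Proof.
case/balanced_ballotP=> cnt dec Ew.
have k_gt0 : 0 < k by case: x {Ew} => x /= /(leq_ltn_trans (leq0n x)).
have lt_k : k.-1 < k by rewrite prednK.
pose y := Ordinal lt_k.
have le_xy : x <= y by rewrite /= -ltnS prednK.
have := dec (size s) x y le_xy.
rewrite Ew -cats1 take_size_cat //.
have := cnt y; have := cnt x; rewrite Ew -cats1 !count_cat /= eqxx.
case: (x =P y) => [-> _ _ _|_] /=; first by rewrite prednK.
lia.
Qed.

End BallotPaths.

(** * Words over up and down letters with at most one peak *)

Section Peaks.

Variables (T : Type) (up : pred T).

Let peaks (s : seq T) :=
  count (fun p => up p.1 && ~~ up p.2) (zip s (behead s)).

(** Read backwards from the final down: an up just before a down would be a peak, so downs propagate
    to the front. *)
Lemma no_peak_down x s :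
  peaks (x :: s) = 0 -> ~~ up (last x s) -> all (predC up) (x :: s).
Proof.
rewrite /peaks; elim: s x => [|y s IHs] x /=; first by rewrite andbT.
move=> H ly; have {}IHs : all (predC up) (y :: s).
  by apply: IHs => //; move: H; case: (up x && _).
rewrite -/(all (predC up) (y :: s)) IHs andbT.
have uy : ~~ up y by case/andP: IHs.
by move: H; rewrite uy; case: (up x).
Qed.

(** The first change from up to down uses the only peak; what follows is peak-free and ends in a
    down, so [no_peak_down] applies. *)
Lemma one_peak_split x s :
  up x -> ~~ up (last x s) -> peaks (x :: s) = 1 ->
  exists m, all up (take m (x :: s)) && all (predC up) (drop m (x :: s)).
Proof.
rewrite /peaks; elim: s x => [|y s IHs] x /=; first by move=> ->.
move=> ux ly; rewrite ux /=; case uy: (up y) => /= H.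
  have [m Hm] := IHs y uy ly H.
  by exists m.+1; rewrite /= ux.
case: H => H; exists 1; by rewrite /= ux; apply: no_peak_down H ly.
Qed.

Lemma down_no_peak s : all (predC up) s -> peaks s = 0.
Proof.
rewrite /peaks; elim: s => [|x [|y s] IHs] //= /andP[/negbTE-> H] /=.
exact: IHs.
Qed.

Lemma split_one_peak a b :
  all up a -> all (predC up) b -> 0 < size a -> 0 < size b ->
  peaks (a ++ b) = 1.
Proof.
move=> + ub + b_gt0; elim: a => [|x [|y a] IHa] //=.
  rewrite andbT => ux _ {IHa}; case: b ub b_gt0 => [|y b] // ub _.
  have /= := down_no_peak ub; rewrite /peaks /= => ->.
  by have /andP[/= -> _] := ub; rewrite ux.
move=> /andP[ux uya] _; have := IHa uya isT; rewrite /peaks /= => ->.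
by have /andP[-> _] := uya; rewrite andbF.
Qed.

End Peaks.

(** * Concatenating two j-dimensional paths *)

Section Halves.

Variables (j n : nat).
Implicit Types (u v : (j * n).-tuple 'I_j) (w : ((j + j) * n).-tuple 'I_(j + j)).

Lemma up_stepE (i : 'I_(j + j)) : up_step i = (i < j).
Proof. by rewrite /up_step (_ : (j + j)./2 = j) // addnn doubleK. Qed.

Lemma down_stepE (i : 'I_(j + j)) : down_step i = ~~ up_step i.
Proof.
rewrite up_stepE /down_step (_ : uphalf (j + j) = j) ?ltnS -?leqNgt //.
by rewrite addnn uphalf_double.
Qed.

Lemma up_lshift (i : 'I_j) : up_step (lshift j i).
Proof. by rewrite up_stepE /= ltn_ord. Qed.

Lemma up_rshift (i : 'I_j) : up_step (rshift j i) = false.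
Proof. by rewrite up_stepE /= ltnNge leq_addr. Qed.

Lemma all_up_lshift (s : seq 'I_(j + j)) :
  all (@up_step _) s -> exists u : seq 'I_j, s = map (lshift j) u.
Proof.
elim: s => [|x s IHs] /=; first by exists [::].
case/andP=> ux /IHs[u ->]; case: (split_ordP x) ux => i ->.
  by exists (i :: u).
by rewrite up_rshift.
Qed.

Lemma all_down_rshift (s : seq 'I_(j + j)) :
  all (predC (@up_step _)) s -> exists v : seq 'I_j, s = map (@rshift j j) v.
Proof.
elim: s => [|x s IHs] /=; first by exists [::].
case/andP=> ux /IHs[v ->]; case: (split_ordP x) ux => i ->.
  by rewrite up_lshift.
by exists (i :: v).
Qed.

Lemma count_lshift_map (i : 'I_j) (u v : seq 'I_j) :
  count_mem (lshift j i) (map (lshift j) u ++ map (@rshift j j) v) = count_mem i u.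
Proof.
rewrite count_cat !count_map [X in _ + X](@eq_count _ _ pred0).
  by rewrite count_pred0 addn0; apply: eq_count => x /=; rewrite eq_lshift.
by move=> x /=; rewrite eq_rlshift.
Qed.

Lemma count_rshift_map (i : 'I_j) (u v : seq 'I_j) :
  count_mem (@rshift j j i) (map (lshift j) u ++ map (@rshift j j) v) = count_mem i v.
Proof.
rewrite count_cat !count_map [X in X + _](@eq_count _ _ pred0).
  by rewrite count_pred0; apply: eq_count => x /=; rewrite eq_rshift.
by move=> x /=; rewrite eq_lrshift.
Qed.

Lemma join_size u v :
  size (map (lshift j) u ++ map (@rshift j j) v) == (j + j) * n.
Proof. by rewrite size_cat !size_map !size_tuple mulnDl. Qed.

(** The dimension is kept as [j + j] so that [lshift] and [rshift] embed the two alphabets as the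
    up-steps and the down-steps. *)
Definition join (p : (j * n).-tuple 'I_j * (j * n).-tuple 'I_j) :
  ((j + j) * n).-tuple 'I_(j + j) := Tuple (join_size p.1 p.2).

Lemma join_inj : injective join.
Proof.
move=> [u v] [u' v'] /(congr1 val) /= /eqP.
rewrite eqseq_cat ?size_map ?size_tuple // => /andP[/eqP Eu /eqP Ev].
congr pair; apply: val_inj.
  exact: (inj_map (@lshift_inj _ _) Eu).
exact: (inj_map (@rshift_inj _ _) Ev).
Qed.

(** Truncated subtraction makes the second prefix empty until [u] is exhausted. *)
Lemma take_join u v m :
  take m (join (u, v)) =
  map (lshift j) (take m u) ++ map (@rshift j j) (take (m - j * n) v).
Proof.
rewrite /= take_cat size_map size_tuple -!map_take; case: ltnP => [lt_m|ge_m].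
  by move: (ltnW lt_m); rewrite -subn_eq0 => /eqP->; rewrite take0 cats0.
by rewrite (@take_oversize _ m u) ?size_tuple.
Qed.

Lemma ballot_join u v :
  balanced_ballot (join (u, v)) = balanced_ballot u && balanced_ballot v.
Proof.
apply/idP/andP => [/balanced_ballotP[cnt dec]|[bu bv]].
  split; apply/balanced_ballotP; split.
  - by move=> i; have := cnt (lshift j i); rewrite count_lshift_map.
  - move=> m i i' le_i; have /(_ le_i) := dec m (lshift j i) (lshift j i').
    by rewrite take_join !count_lshift_map.
  - by move=> i; have := cnt (rshift j i); rewrite count_rshift_map.
  (* Prefixes of [v] are seen in the joined path after the [j * n] steps of [u]. *)
  - move=> m i i' le_i; have := dec (m + j * n) (rshift j i) (rshift j i').
    by rewrite take_join !count_rshift_map addnK /= leq_add2l; apply.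
have [cu du] := balanced_ballotP _ bu; have [cv dv] := balanced_ballotP _ bv.
apply/balanced_ballotP; split => [i|m x y].
  by case: (split_ordP i) => i' ->; rewrite ?count_lshift_map ?count_rshift_map.
rewrite take_join.
case: (split_ordP x) => i ->; case: (split_ordP y) => i' -> /=;
  rewrite ?count_lshift_map ?count_rshift_map.
- exact: du.
(* Up-coordinate against down-coordinate: either [v] has not started and the latter is 0, or [u] is
   complete and the former is n. *)
- move=> _; have [le_m|/ltnW le_m] := leqP m (j * n).
    by move: (le_m); rewrite -subn_eq0 => /eqP->; rewrite take0.
  by rewrite (@take_oversize _ m) ?size_tuple // cu count_take_le.
- by have := ltn_ord i'; lia.
- by rewrite leq_add2l; apply: dv.
Qed.

(** The cut [m] need not be given as [j * n]: each letter occurs n times, which forces both halves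
    to have that length. *)
Lemma split_join w m :
  balanced_ballot w -> all (@up_step _) (take m w) ->
  all (predC (@up_step _)) (drop m w) -> exists p, w = join p.
Proof.
move=> /balanced_ballotP[cnt _] /all_up_lshift[u Eu] /all_down_rshift[v Ev].
have Ew : val w = map (lshift j) u ++ map (@rshift j j) v.
  by rewrite -Eu -Ev cat_take_drop.
have szu : size u == j * n.
  rewrite size_sum_count (eq_bigr (fun=> n)) ?sum_nat_const ?card_ord // => i _.
  by rewrite -(cnt (lshift j i)) Ew count_lshift_map.
have szv : size v == j * n.
  rewrite size_sum_count (eq_bigr (fun=> n)) ?sum_nat_const ?card_ord // => i _.
  by rewrite -(cnt (rshift j i)) Ew count_rshift_map.
by exists (Tuple szu, Tuple szv); apply: val_inj.
Qed.

(** Common to both equalities: [P] will be having one peak, then having maximal height. *)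
Lemma card_ballot_join (P : pred (((j + j) * n).-tuple 'I_(j + j))) :
  (forall u v, balanced_ballot (join (u, v)) -> P (join (u, v))) ->
  (forall w, balanced_ballot w -> P w ->
     exists m, all (@up_step _) (take m w) && all (predC (@up_step _)) (drop m w)) ->
  #|[set w | balanced_ballot w && P w]| = num_ballot j n ^ 2.
Proof.
move=> Pjoin joinP; rewrite /num_ballot -mulnn -cardsX -(card_imset _ join_inj).
congr #|pred_of_set _|; apply/setP => w; rewrite inE; apply/andP/imsetP.
  move=> [bw Pw]; have [m /andP[um dm]] := joinP w bw Pw.
  have [[u v] Ew] := split_join bw um dm.
  by exists (u, v) => //; rewrite !inE -ballot_join -Ew.
move=> [[u v]]; rewrite !inE -ballot_join => bj ->.
by split=> //; apply: Pjoin.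
Qed.

Lemma num_peaksE (s : seq 'I_(j + j)) :
  num_peaks s =
  count (fun p => up_step p.1 && ~~ up_step p.2) (zip s (behead s)).
Proof. by apply: eq_count => p; rewrite down_stepE. Qed.

Lemma all_up_join u : all (@up_step _) (map (lshift j) u).
Proof. by apply/allP => x /mapP[i _ ->]; rewrite up_lshift. Qed.

Lemma all_down_join v : all (predC (@up_step _)) (map (@rshift j j) v).
Proof. by apply/allP => x /mapP[i _ ->]; rewrite /= up_rshift. Qed.

Lemma num_ballot_one_peak :
  0 < j -> 0 < n -> num_ballot_peaks (j + j) 1 n = num_ballot j n ^ 2.
Proof.
move=> j_gt0 n_gt0; apply: card_ballot_join => [u v _|w bw /eqP].
  apply/eqP; rewrite num_peaksE; apply: split_one_peak;
    rewrite ?size_map ?size_tuple ?muln_gt0 ?j_gt0 //.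
    exact: all_up_join.
  exact: all_down_join.
rewrite num_peaksE.
have : size w = (j + j) * n by rewrite size_tuple.
case Ew : (val w) => [|x s] /= => [/eqP|_].
  by rewrite eq_sym muln_eq0; case: (j) (n) j_gt0 n_gt0 => [|?] [|?].
apply: one_peak_split; first by rewrite up_stepE (ballot_head bw Ew).
rewrite up_stepE -leqNgt -ltnS (ballot_last bw (etrans Ew (lastI x s))).
by rewrite -addn1 leq_add2l.
Qed.

(** * The semisymmetric height and its maximum *)

Section Height.

Import GRing.Theory Num.Theory Order.TTheory.

                                                                              
                                                   
(** The height has coefficients 2j-1, ..., 3, 1 on the up-coordinates and -1, -3, ..., -(2j-1) on
    the down-coordinates. Writing x_i = n - (n - x_i) in the first half isolates the constant j^2
    n. *)
Lemma point_heightE (x : 'I_(j + j) -> nat) :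
  (forall i, x i <= n) ->
  point_height x =
  ((j ^ 2 * n)%N%:Z - (\sum_(i < j) (2 * (j - i)).-1 * (n - x (lshift j i)) +
                       \sum_(i < j) i.*2.+1 * x (rshift j i))%N%:Z)%R.
Proof.
move=> x_le.
(* The first j odd numbers, listed in decreasing order, sum to j^2. *)
have sum_odd : (j ^ 2 * n = \sum_(i < j) (2 * (j - i)).-1 * n)%N.
  rewrite -big_distrl /=; congr (_ * _)%N.
  elim: (j) => [|h IHh]; first by rewrite big_ord0.
  rewrite big_ord_recl (eq_bigr (fun i : 'I_h => (2 * (h - i)).-1)) //.
  by rewrite -IHh subn0; lia.
rewrite sum_odd /point_height big_split_ord /= PoszD opprD addrA.
rewrite !(big_morph Posz PoszD (erefl _)) -sumrB -sumrN.
congr (_ + _)%R; apply: eq_bigr => i _.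
  by have := x_le (lshift j i); have := ltn_ord i; nia.
by nia.
Qed.

Lemma point_height_le (x : 'I_(j + j) -> nat) :
  (forall i, x i <= n) -> (point_height x <= (j ^ 2 * n)%N%:Z)%R.
Proof. by move/point_heightE->; rewrite gerBl. Qed.

Lemma point_height_max (x : 'I_(j + j) -> nat) :
  (forall i, x i <= n) ->
  (point_height x == Posz (j ^ 2 * n)) =
  [forall i, (x (lshift j i) == n) && (x (rshift j i) == 0)].
Proof.
move=> x_le; rewrite point_heightE // subr_eq addrC -subr_eq subrr eq_sym.
rewrite eqz_nat addn_eq0 !sum_nat_eq0.
apply/andP/forallP => [[/forallP Hl /forallP Hr] i|H].
  have := Hl i; have := Hr i; have := x_le (lshift j i); have := ltn_ord i.
  by rewrite /= !muln_eq0; lia.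
by split; apply/forallP => i; have /andP[/eqP Hl /eqP Hr] := H i;
  rewrite /= ?Hl ?Hr ?subnn muln0.
Qed.

Lemma path_heightP w :
  balanced_ballot w ->
  reflect (exists m, point_height (point w m) = Posz (j ^ 2 * n))
          (path_height w == Posz (j ^ 2 * n)).
Proof.
move=> bw.
have le_max m : (point_height (point w m) <= Posz (j ^ 2 * n))%R.
  by apply: point_height_le => i; apply: count_take_le.
apply: (iffP eqP) => [<-|[m Hm]].
  rewrite /path_height; apply: (big_ind (fun h => exists m, _ = h)).
  - by exists 0.
  - by move=> _ _ [m <-] [p <-]; rewrite /Order.max; case: ifP; [exists p|exists m].
  - by move=> m _; exists m.
apply/eqP; rewrite eq_le; apply/andP; split; first exact: bigmax_le.
(* The maximum ranges over indices up to [size w], so an arbitrary [m] is capped there without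
   changing the point. *)
have -> : Posz (j ^ 2 * n) = point_height (point w (minn m (size w))).
  rewrite -Hm /point; case: leqP => // /ltnW le_m.
  by rewrite take_size take_oversize.
have lt_m : minn m (size w) < (size w).+1 by rewrite ltnS geq_minr.
exact: (le_bigmax _ (fun i : 'I__ => point_height (point w i)) (Ordinal lt_m)).
Qed.

Lemma num_ballot_max_height :
  num_ballot_height (j + j) (Posz (j ^ 2 * n)) n = num_ballot j n ^ 2.
Proof.
apply: card_ballot_join => [u v bj|w bw /(path_heightP bw)[m]].
  apply/(path_heightP bj); exists (j * n); apply/eqP.
  rewrite point_height_max => [|i]; last exact: count_take_le.
  move: bj; rewrite ballot_join => /andP[/balanced_ballotP[cu _] _].
  apply/forallP => i; rewrite /point take_join count_lshift_map count_rshift_map.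
  by rewrite subnn take0 take_oversize ?size_tuple // cu !eqxx.
move/eqP; rewrite point_height_max => [/forallP H|i]; last exact: count_take_le.
have [cnt _] := balanced_ballotP _ bw.
(* At the extremal point no down-step has occurred yet, and all n copies of each up-step are used,
   so none remain. *)
exists m; apply/andP; split; apply/allP => x; case: (split_ordP x) => i ->.
- by rewrite up_lshift.
- by have /andP[_ /eqP/count_memPn/negbTE->] := H i.
- have /andP[/eqP Hi _] := H i; have := cnt (lshift j i).
  rewrite -{1}(cat_take_drop m w) count_cat -[count_mem _ (take m w)]/(point w m _).
  by rewrite Hi -[RHS]addn0 => /addnI/count_memPn/negbTE->.
- by rewrite /= up_rshift.
Qed.

End Height.

End Halves.

Theorem theorem6p5 (k n : nat) (hk : 2 <= k) (hkeven : ~~ odd k) (hn : 1 <= n) :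
  num_ballot_peaks k 1 n = num_ballot (k./2) n ^ 2 /\
  num_ballot (k./2) n ^ 2 = num_ballot_height k (((k./2) ^ 2 * n)%N%:Z)%R n.
Proof.
have half_gt0 : 0 < k./2 by rewrite half_gt0.
have Ek : k = k./2 + k./2 by rewrite addnn even_halfK.
(* Generalizing [k./2] to [j] first lets [k] be replaced by [j + j] without touching the half
   itself. *)
move: {hk hkeven} (k./2) half_gt0 Ek => j j_gt0 ->.
by rewrite num_ballot_one_peak // num_ballot_max_height.
Qed.
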